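(* For every integer $k\geq 29$ there exist infinitely many finite simple graphs $G$ such that $G$ has no $\{P_{2},P_{2k+1}\}$-factor and $$\sum_{0\leq j\leq k-1} c_{2j+1}(G-X)\leq \frac{32k+141}{72k-78}|X| \quad\text{for all } X\subseteq V(G).$$
   Context: For a graph $H$ and an integer $j\geq 1$, $c_{j}(H)$ denotes the number of connected components of $H$ having exactly $j$ vertices. $P_n$ denotes the path on $n$ vertices. A $\{P_2,P_{2k+1}\}$-factor of $G$ is a spanning subgraph of $G$ each of whose components is isomorphic to $P_2$ or to $P_{2k+1}$. *)

(* Defs.v *)
From mathcomp Require Import all_boot all_order all_algebra.
Set Implicit Arguments. Unset Strict Implicit. Unset Printing Implicit Defensive.

Section Graphs.
Variable T : finType.

Definition simple_graph (e : rel T) : Prop := symmetric e /\ irreflexive e.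

Definition del_rel (e : rel T) (X : {set T}) : rel T :=
  fun x y => [&& x \notin X, y \notin X & e x y].

Definition components (e : rel T) (X : {set T}) : {set {set T}} :=
  [set [set y | connect (del_rel e X) x y] | x in ~: X].

Definition ncomp (e : rel T) (X : {set T}) (j : nat) : nat :=
  #|[set C in components e X | #|C| == j]|.

Definition induces_path (F : rel T) (C : {set T}) (m : nat) : Prop :=
  exists s : seq T, [/\ uniq s, size s = m, (forall x, (x \in C) = (x \in s)) &
    {in C &, forall x y, F x y =
       ((index x s).+1 == index y s) || ((index y s).+1 == index x s)}].

Definition has_P2_P2k1_factor (e : rel T) (k : nat) : Prop :=
  exists F : rel T, [/\ symmetric F, (forall x y, F x y -> e x y) &
    forall C, C \in components F set0 ->
      induces_path F C 2 \/ induces_path F C (2 * k + 1)].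

End Graphs.

(* Main.v *)
Require Import Defs.
From mathcomp Require Import all_boot all_order all_algebra.
From mathcomp Require Import zify.

(** Take a clique [hub] of [l] vertices joined to everything, a clique [core], and
    [m] pairs of adjacent vertices [a_i, b_i] whose only neighbours outside the
    hub are each other and one private vertex [z_i] of the core; the total order
    is [2k+3], and a large disjoint clique makes the family infinite.

    The order [2k+3] is odd, so a factor contains a path on [2k+1] of these
    vertices, missing only two.  A pair that avoids the missed vertices, the ends
    of the path and the path-neighbours of the hub would be traversed together
    with [z_i] as a triangle.  Hence [m <= 2l+4] whenever a factor exists.

    Isolating one vertex of a pair costs two deleted vertices (a pair itself has
    even order), and nothing separates before the whole hub is deleted, so [f+1]
    small odd components cost [l+2f] vertices, where [f <= m].  With
    [(l, m) = (2, 9)] the ratio is at most 1/2, enough for [k <= 45]; with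
    [(l, m) = (7, 19)] it is at most 4/9.  *)

Set Implicit Arguments. Unset Strict Implicit. Unset Printing Implicit Defensive.

(** * Reachability and the count of small odd components *)

Lemma connect_preserves (T : finType) (r : rel T) (P : pred T) (x y : T) :
  (forall u v, r u v -> P u -> P v) -> connect r x y -> P x -> P y.
Proof.
move=> rP /connectP[p + ->]; elim: p x => [|z p IHp] x //= /andP[xz pz] Px.
exact: IHp pz (rP _ _ xz Px).
Qed.

(** The sizes [2 * j + 1] with [j < k] are distinct odd numbers below [2 * k], so the summands count
    disjoint families of components. *)
Lemma sum_ncomp_odd (T : finType) (e : rel T) (X : {set T}) (k : nat) :
  \sum_(0 <= j < k) ncomp e X (2 * j + 1) <=
    #|[set C in components e X | odd #|C| && (#|C| < 2 * k)]|.
Proof.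
elim: k => [|k IHk]; first by rewrite big_geq.
rewrite big_nat_recr //=; apply: leq_trans (leq_add IHk (leqnn _)) _.
rewrite /ncomp -cardsUI; set I := _ :&: _; have -> : I = set0.
  by apply/setP => C; rewrite !inE; case: (_ \in _) => //=; lia.
rewrite cards0 addn0; apply: subset_leq_card; apply/subsetP => C.
by rewrite !inE; case: (_ \in _) => //=; lia.
Qed.

Lemma card_ord_lt (n j : nat) : j <= n -> #|[set x : 'I_n | x < j]| = j.
Proof.
move=> jn; rewrite -sum1_card (eq_bigl (fun x : 'I_n => x < j)) => [|x]; last by rewrite inE.
by rewrite -(big_ord_widen n (fun=> 1)) // sum1_card card_ord.
Qed.

(** * The graph and its vertex layout *)

Section Graph.
Variables (c l m n' : nat).
Hypotheses (lmc : l + 3 * m <= c) (cn : c <= n'.+1).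
Local Notation n := n'.+1.

(* Vertices [0, l) form the hub, [l + i] is [a_i], [l + m + i] is [b_i],
   [l + 2m, c) is the core with [z_i = l + 2m + i], and [c, n) is the disjoint
   clique. *)
Definition half_adj (x y : nat) : bool :=
  [|| x < l,
      (l + 2 * m <= x) && (l + 2 * m <= y),
      [&& l <= x, x < l + 2 * m & y == x + m]
    | [&& l <= x, x < l + m & y == x + 2 * m]].

Definition hedgehog : rel 'I_n := fun x y =>
  (val x != val y) &&
  ((c <= x) && (c <= y) || [&& x < c, y < c & half_adj x y || half_adj y x]).

Lemma hedgehog_simple : simple_graph hedgehog.
Proof. by split=> [x y | x]; rewrite /hedgehog /half_adj; lia. Qed.

Definition vtx (j : nat) : 'I_n := inord j.

Lemma vtxK (j : nat) : j < c -> vtx j = j :> nat.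
Proof. by move=> jc; rewrite inordK //; lia. Qed.

Definition body : {set 'I_n} := [set x : 'I_n | x < c].
Definition hub : {set 'I_n} := [set x : 'I_n | x < l].

Lemma card_hub : #|hub| = l.
Proof. by rewrite card_ord_lt //; lia. Qed.

Lemma card_body : #|body| = c.
Proof. by rewrite card_ord_lt. Qed.

(** * Components after deleting a vertex set *)

Section Deletion.
Variable X : {set 'I_n}.
Let r := del_rel hedgehog X.
Let comp x := [set y | connect r x y].

Lemma connect_del (x y : 'I_n) : x \notin X -> y \notin X -> hedgehog x y -> connect r x y.
Proof. by move=> xX yX xy; apply: connect1; rewrite /r /del_rel xX yX. Qed.

Lemma r_sym : connect_sym r.
Proof.
apply: sym_connect_sym => x y; rewrite /r /del_rel (hedgehog_simple.1 x).
by case: (x \in X) => //=; rewrite andbF.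
Qed.

Lemma comp_eq (x y : 'I_n) : connect r x y -> comp x = comp y.
Proof. by move=> xy; apply/setP => z; rewrite !inE (same_connect r_sym xy). Qed.

Lemma comp_side (x y : 'I_n) : x \notin X -> connect r x y ->
  (y \notin X) && ((y < c) == (x < c)).
Proof.
move=> xX xy.
apply: (connect_preserves (P := fun y => (y \notin X) && ((y < c) == (x < c)))) xy _.
  by move=> u v /and3P[_ -> ]; rewrite /hedgehog; lia.
by rewrite xX eqxx.
Qed.

Lemma comp_tail (x : 'I_n) : x \notin X -> c <= x -> comp x = ~: body :\: X.
Proof.
move=> xX cx; apply/setP => y; rewrite !inE; apply/idP/andP => [/(comp_side xX)|[yX cy]].
  by case/andP=> ->; split => //; lia.
have [-> // | xy] := eqVneq x y.
by apply: connect_del => //; rewrite /hedgehog -val_eqE in xy *; rewrite xy; lia.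
Qed.

(** A surviving hub vertex is adjacent to every other remaining body vertex. *)
Lemma comp_body (x : 'I_n) : ~~ (hub \subset X) -> x \notin X -> x < c ->
  comp x = body :\: X.
Proof.
case/subsetPn => w; rewrite inE => wl wX xX cx.
have toW (y : 'I_n) : y \notin X -> y < c -> connect r y w.
  move=> yX yc; have [-> // | yw] := eqVneq y w.
  by apply: connect_del => //; rewrite /hedgehog /half_adj -val_eqE in yw *; rewrite yw; lia.
apply/setP => y; rewrite !inE; apply/idP/andP => [/(comp_side xX)|[yX cy]].
  by case/andP=> ->; split => //; lia.
by apply: connect_trans (toW x xX cx) _; rewrite r_sym; apply: toW.
Qed.

Definition core (x : nat) : bool := (l + 2 * m <= x) && (x < c).

(** Defined as a union over the surviving core, to avoid choosing a representative. The core is a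
    clique, so this is one component, or empty if the whole core is deleted. *)
Definition core_comp : {set 'I_n} :=
  [set y | [exists u, [&& core (val u), u \notin X & connect r u y]]].

Lemma comp_core (x : 'I_n) : x \notin X -> core x -> comp x = core_comp.
Proof.
move=> xX cx; apply/setP => y; rewrite !inE; apply/idP/existsP => [xy|].
  by exists x; rewrite xX xy /= cx.
case=> u /and3P[cu uX]; apply: connect_trans.
have [-> // | xu] := eqVneq x u.
apply: connect_del => //; rewrite /hedgehog /half_adj -val_eqE in xu *; rewrite xu /=.
by move: cx cu; rewrite /core /=; lia.
Qed.

(** * Pairs cut off from the core *)

Let a (i : 'I_m) := vtx (l + i).
Let b (i : 'I_m) := vtx (l + m + i).
Let z (i : 'I_m) := vtx (l + 2 * m + i).

Lemma val_a i : a i = l + i :> nat. Proof. by rewrite vtxK //; have := ltn_ord i; lia. Qed.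
Lemma val_b i : b i = l + m + i :> nat. Proof. by rewrite vtxK //; have := ltn_ord i; lia. Qed.
Lemma val_z i : z i = l + 2 * m + i :> nat. Proof. by rewrite vtxK //; have := ltn_ord i; lia. Qed.

(** For these pairs [inner i] is the deleted vertex and [outer i] the survivor, which is isolated
    once the hub is deleted too. *)
Let split_pairs : {set 'I_m} := [set i | (z i \in X) && ((a i \in X) (+) (b i \in X))].
Let inner i := if a i \in X then a i else b i.
Let outer i := if a i \in X then b i else a i.

(** The hub, the vertices [z i] and the vertices [inner i] are pairwise disjoint groups inside
    [X]. *)
Lemma card_split_pairs : hub \subset X -> l + 2 * #|split_pairs| <= #|X :&: body|.
Proof.
move=> hubX.
have zI : {in split_pairs &, injective z}.
  by move=> i j _ _ /(congr1 val) /=; rewrite !val_z => ij; apply: val_inj => /=; lia.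
have innerE i : inner i = l + i :> nat \/ inner i = l + m + i :> nat.
  by rewrite /inner; case: ifP => _; [left; rewrite val_a | right; rewrite val_b].
have innerI : {in split_pairs &, injective inner}.
  move=> i j _ _ /(congr1 val) /= ij; apply: val_inj => /=.
  by have := innerE i; have := innerE j; have := ltn_ord i; have := ltn_ord j; lia.
rewrite -card_hub mul2n -addnn -{1}(card_in_imset zI) -(card_in_imset innerI).
have dzi : [disjoint z @: split_pairs & inner @: split_pairs].
  apply/pred0P => x /=; apply/negP => /andP[/imsetP[i _ ->] /imsetP[j _ /(congr1 val)]] /=.
  by rewrite val_z; have := innerE j; have := ltn_ord j; lia.
have dh : [disjoint hub & z @: split_pairs :|: inner @: split_pairs].
  apply/pred0P => x /=; apply/negP => /andP[]; rewrite !inE => xl.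
  by case/orP => /imsetP[i _ xE]; move: xl; rewrite xE ?val_z; have := innerE i; lia.
have cU (A B : {set 'I_n}) : [disjoint A & B] -> #|A| + #|B| = #|A :|: B|.
  by move=> dAB; apply/esym/eqP; rewrite leq_card_setU.
rewrite (cU _ _ dzi) (cU _ _ dh).
apply: subset_leq_card; rewrite !subUset !subsetI hubX /=.
apply/and3P; split; first by apply/subsetP => x; rewrite !inE; lia.
  apply/andP; split; apply/subsetP => x /imsetP[i]; rewrite !inE => /andP[zX _] -> //.
  by rewrite val_z; have := ltn_ord i; lia.
apply/andP; split; apply/subsetP => x /imsetP[i]; rewrite !inE => /andP[_ abX] -> //.
  by rewrite /inner; case: ifPn => // aX; move: abX; rewrite (negPf aX).
by have := innerE i; have := ltn_ord i; lia.
Qed.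

Lemma comp_pair (x : 'I_n) : hub \subset X -> x \notin X ->
    l <= x < l + 2 * m -> odd #|comp x| ->
  (comp x == core_comp) || (comp x \in [set comp (outer i) | i in split_pairs]).
Proof.
move=> hubX xX xlm oddx.
have [i xi] : exists i : 'I_m, x = a i \/ x = b i.
  have [xa | xa] := ltnP x (l + m).
    have im : x - l < m by lia.
    by exists (Ordinal im); left; apply: val_inj; rewrite /= val_a /=; lia.
  have im : x - (l + m) < m by lia.
  by exists (Ordinal im); right; apply: val_inj; rewrite /= val_b /=; lia.
have im := ltn_ord i.
(* A surviving [z i] merges the component into that of the core. *)
have [zX | zX] := boolP (z i \in X); last first.
  have xz : connect r x (z i).
    by apply: connect_del => //; rewrite /hedgehog /half_adj /= val_z; case: xi => ->;
      rewrite ?val_a ?val_b; lia.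
  by rewrite (comp_eq xz) comp_core ?eqxx // /core val_z; lia.
have sub y : connect r x y -> (y == a i) || (y == b i).
  move=> xy; apply: (connect_preserves (P := fun y => (y == a i) || (y == b i))) xy _; last first.
    by case: xi => ->; rewrite eqxx ?orbT.
  move=> u v /and3P[uX vX uv] uab.
  have vz : v != z i by apply: contraNneq vX => ->.
  have vl : l <= v by rewrite leqNgt; apply: contraNN vX => vl; apply: (subsetP hubX); rewrite inE.
  move: uv uab vz; rewrite /hedgehog /half_adj -!val_eqE /= val_a val_b val_z; lia.
(* Since [x] survives, the only alternative is an intact pair, whose component has even order
   two. *)
have abX : (a i \in X) (+) (b i \in X).
  apply: contraLR oddx => nab.
  have [aX bX] : a i \notin X /\ b i \notin X.
    by move: nab; case: xi xX => -> /negPf->; case: (_ \in _).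
  have ab : connect r (a i) (b i).
    by apply: connect_del => //; rewrite /hedgehog /half_adj /= val_a val_b; lia.
  suff -> : comp x = [set a i; b i].
    by rewrite cards2 -val_eqE /= val_a val_b; lia.
  apply/setP => y; rewrite !inE; apply/idP/idP => [/sub // |].
  by case: xi => -> /orP[] /eqP -> //; rewrite r_sym.
apply/orP; right; apply/imsetP; exists i; first by rewrite inE zX.
congr comp; rewrite /outer; case: xi xX abX => -> /negPf->; case: (_ \in _) => //=.
Qed.

(** * Bounding the counted components by [p / q] times the deleted vertices *)

Variables (k p q : nat).
Hypotheses (ck : c = 2 * k + 3) (nc : 2 * c <= n).

Let counted := [set C in components hedgehog X | odd #|C| && (#|C| < 2 * k)].

Lemma countedP C : C \in counted -> exists2 x, x \notin X &
  [/\ C = comp x, odd #|comp x| & #|comp x| < 2 * k].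
Proof.
rewrite inE => /andP[/imsetP[x]]; rewrite inE => xX -> /andP[oddC smallC].
by exists x.
Qed.

Let tail_counted := [set C in counted | [disjoint C & body]].
Let body_counted := [set C in counted | C \subset body].

(** The tail clique has at least [2 * k + 3] vertices, so its single component is smaller than
    [2 * k] only after at least four deletions. *)
Lemma card_tail_counted : q <= 4 * p -> q * #|tail_counted| <= p * #|X :\: body|.
Proof.
move=> qp.
have sub : tail_counted \subset [set ~: body :\: X].
  apply/subsetP => C; rewrite inE => /andP[/countedP[x xX [-> _ _]] dis].
  rewrite inE comp_tail // leqNgt; apply/negP => xc.
  by move/pred0P/(_ x): dis; rewrite !inE connect0 xc.
have := subset_leq_card sub; rewrite cards1.
have [-> | /set0Pn[C CT]] := eqVneq tail_counted set0; first by rewrite cards0; lia.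
have /set1P CE := subsetP sub C CT.
move: CT; rewrite inE CE => /andP[/countedP[x xX [<- _ small]] _].
have := cardsID X (~: body); rewrite setIC -setDE -CE.
have := cardsC body; rewrite card_body card_ord CE => cb cX t1.
have x4 : 4 <= #|X :\: body|.
  by move: small cb cX; move: #|~: body :\: X| #|~: body| #|X :\: body| => *; lia.
apply: leq_trans (leq_mul (leqnn q) t1) _; rewrite muln1.
by apply: leq_trans qp _; rewrite mulnC leq_mul2l x4 orbT.
Qed.

Hypothesis qp : forall f, f <= m -> q * f.+1 <= p * (l + 2 * f).

(** With the hub deleted, at most the core component and the [f] isolated survivors count, and [qp]
    applies. Otherwise the remaining body is one component, small only after four deletions. *)
Lemma card_body_counted : q <= 4 * p -> q * #|body_counted| <= p * #|X :&: body|.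
Proof.
move=> qp4; have [hubX | hubX] := boolP (hub \subset X).
  have sub : body_counted \subset
      core_comp |: [set comp (outer i) | i in split_pairs].
    apply/subsetP => C; rewrite inE => /andP[/countedP[x xX [-> oddx _]] Cb].
    have xc : x < c by move/subsetP/(_ x): Cb; rewrite !inE connect0 => ->.
    have xl : l <= x.
      by rewrite leqNgt; apply: contraNN xX => xl; apply: (subsetP hubX); rewrite inE.
    rewrite in_setU1; have [xm | xm] := ltnP x (l + 2 * m).
      by apply: comp_pair => //; rewrite xl.
    by rewrite comp_core ?eqxx // /core xm.
  have := subset_leq_card sub; rewrite cardsU1.
  have := leq_imset_card (fun i => comp (outer i)) split_pairs.
  have := card_split_pairs hubX; have := max_card split_pairs; rewrite card_ord => /qp.
  move: #|split_pairs| #|X :&: body| #|body_counted| => f x cnt.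
  move: #|[set _ | _ in _]| (_ \notin _) => g [] /= qf lx gf cg;
  by apply: leq_trans (leq_trans qf _); rewrite leq_mul2l ?lx ?orbT //; lia.
have sub : body_counted \subset [set body :\: X].
  apply/subsetP => C; rewrite inE => /andP[/countedP[x xX [-> _ _]] Cb].
  rewrite inE comp_body //.
  by move/subsetP/(_ x): Cb; rewrite !inE connect0 => ->.
have := subset_leq_card sub; rewrite cards1.
have [-> | /set0Pn[C CT]] := eqVneq body_counted set0; first by rewrite cards0; lia.
have /set1P CE := subsetP sub C CT.
move: CT; rewrite inE CE => /andP[/countedP[x xX [<- _ small]] _].
have := cardsID X body; rewrite card_body setIC => cX t1.
have x4 : 4 <= #|X :&: body|.
  by move: small cX; move: #|body :\: X| #|X :&: body| => *; lia.
apply: leq_trans (leq_mul (leqnn q) t1) _; rewrite muln1.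
by apply: leq_trans qp4 _; rewrite mulnC leq_mul2l x4 orbT.
Qed.

Lemma hedgehog_counted :
  q <= 4 * p -> q * (\sum_(0 <= j < k) ncomp hedgehog X (2 * j + 1)) <= p * #|X|.
Proof.
move=> qp4; rewrite -(cardsID body X) mulnDr.
apply: leq_trans (leq_add (card_body_counted qp4) (card_tail_counted qp4)).
rewrite -mulnDr leq_mul2l; apply/orP; right.
apply: leq_trans (sum_ncomp_odd _ _ _) _.
apply: leq_trans (leq_card_setU _ _); apply: subset_leq_card; apply/subsetP => C CC.
rewrite in_setU !inE -!/counted; rewrite -/counted in CC.
have [x xX [CE _ _]] := countedP CC.
rewrite inE in CC; rewrite CC CE /=.
have [xc | xc] := ltnP x c; apply/orP; [left | right].
  by apply/subsetP => y; rewrite !inE => /(comp_side xX)/andP[_]; lia.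
by apply/pred0P => y; rewrite !inE; apply/negP => /andP[/(comp_side xX)/andP[_]]; lia.
Qed.

End Deletion.

(** * Nonexistence of the factor *)

Lemma factor_long_path (k : nat) (F : rel 'I_n) : c = 2 * k + 3 -> symmetric F ->
  (forall x y, F x y -> hedgehog x y) ->
  (forall C, C \in components F set0 ->
      induces_path F C 2 \/ induces_path F C (2 * k + 1)) ->
  exists2 C : {set 'I_n}, C \subset body & induces_path F C (2 * k + 1).
Proof.
move=> ck Fsym Fe Fcomp; pose R := connect (del_rel F set0).
have Rsym : connect_sym (del_rel F set0).
  by apply: sym_connect_sym => x y; rewrite /del_rel !inE Fsym.
have Rside x y : R x y -> x < c -> y < c.
  apply: (connect_preserves (P := fun y : 'I_n => y < c)) => u v /and3P[_ _ /Fe].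
  by rewrite /hedgehog; lia.
have partR : partition (equivalence_partition R body) body.
  apply: equivalence_partitionP => x y z _ _ _; split; first exact: connect0.
  by move=> xy; rewrite /R (same_connect Rsym xy).
(* The body has odd order [2 * k + 3], so some block is odd and cannot be a path on two vertices. *)
have /existsP[C /andP[CP oddC]] : [exists C in equivalence_partition R body, odd #|C|].
  apply/existsP; apply/existsP; apply: contraT; rewrite negb_exists => /forallP evenP.
  have : ~~ odd #|body|.
    rewrite (card_partition partR); apply: (big_ind (fun j => ~~ odd j)) => // [i j|C CP].
      by rewrite oddD => /negPf-> /negPf->.
    by have := evenP C; rewrite CP.
  by rewrite card_body ck; lia.
have Csub : C \subset body by rewrite -(cover_partition partR); apply: bigcup_sup.
exists C => //.
have CF : C \in components F set0.
  case/imsetP: CP => x; rewrite inE => xc ->; apply/imsetP; exists x; first by rewrite !inE.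
  apply/setP => y; rewrite !inE; apply: andb_idl => xy; exact: Rside xy xc.
case: (Fcomp C CF) => // -[s [us ss Cs _]].
by move: oddC; rewrite (eq_card Cs) (card_uniqP us) ss.
Qed.

Lemma hedgehog_no_factor (k : nat) :
  c = 2 * k + 3 -> 2 * l + 5 <= m -> ~ has_P2_P2k1_factor hedgehog k.
Proof.
move=> ck lm [F [Fsym Fe Fcomp]].
have [C Csub [s [us ss Cs FC]]] := factor_long_path ck Fsym Fe Fcomp.
have cardC : #|C| = 2 * k + 1 by rewrite (eq_card Cs) (card_uniqP us).
pose pos x := index x s; pose at_ := nth (vtx 0) s.
have atK x : x \in C -> at_ (pos x) = x by rewrite Cs; apply: nth_index.
have posK j : j < 2 * k + 1 -> pos (at_ j) = j by move=> jk; rewrite /pos index_uniq ?ss.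
(* Missed vertices, path ends, then successors and predecessors of hub vertices. For a hub vertex
   off the path or at an end, default values may add a spare vertex, within the same bound. *)
pose bad := (body :\: C) :|: [set at_ 0; at_ (2 * k)] :|:
  ([set at_ (pos w).+1 | w in hub] :|: [set at_ (pos w).-1 | w in hub]).
have card_bad : #|bad| <= 2 * l + 4.
  rewrite (_ : 2 * l + 4 = (2 + 2) + (l + l)); last by lia.
  apply: leq_trans (leq_card_setU _ _) (leq_add _ _).
    apply: leq_trans (leq_card_setU _ _) (leq_add _ _); last by rewrite cards2; case: (_ != _).
    by rewrite cardsD (setIidPr Csub) cardC card_body; lia.
  by apply: leq_trans (leq_card_setU _ _) (leq_add _ _);
    apply: leq_trans (leq_imset_card _ _) _; rewrite card_hub.
have nbrs (x : 'I_n) : x < c -> x \notin bad -> exists y1 y2 : 'I_n,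
    [/\ (pos y1).+1 = pos x, pos y2 = (pos x).+1, hedgehog x y1 && (l <= y1)
      & hedgehog x y2 && (l <= y2)].
  move=> xc; rewrite !inE xc andbT !negb_or negbK.
  move=> /andP[/andP[xC /andP[x0 xk]] /andP[xsucc xpred]].
  have posx : pos x < 2 * k + 1 by rewrite -ss index_mem -Cs.
  have pos0 : pos x != 0 by apply: contraNneq x0 => x0; rewrite -{1}(atK x xC) x0.
  have posk : pos x != 2 * k by apply: contraNneq xk => xk; rewrite -{1}(atK x xC) xk.
  have atC j : j < 2 * k + 1 -> at_ j \in C by move=> jk; rewrite Cs mem_nth ?ss.
  have j1 : (pos x).-1 < 2 * k + 1 by lia.
  have j2 : (pos x).+1 < 2 * k + 1 by lia.
  exists (at_ (pos x).-1), (at_ (pos x).+1); rewrite !posK //; split=> //; first by lia.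
    rewrite Fe ?FC ?atC // -/(pos x) -/(pos _) ?posK //; last by lia.
    rewrite leqNgt; apply: contraNN xsucc => yl; apply/imsetP.
    exists (at_ (pos x).-1); rewrite ?inE // posK // prednK ?lt0n // atK //.
  rewrite Fe ?FC ?atC // -/(pos x) -/(pos _) ?posK //; last by lia.
  rewrite leqNgt; apply: contraNN xpred => yl; apply/imsetP.
  by exists (at_ (pos x).+1); rewrite ?inE // posK //= atK.
have pair_bad (i : 'I_m) : (vtx (l + i) \in bad) || (vtx (l + m + i) \in bad).
  apply: contraT; rewrite negb_or => /andP[aB bB]; have im := ltn_ord i.
  set a := vtx (l + i) in aB; set b := vtx (l + m + i) in bB; pose z := vtx (l + 2 * m + i).
  have aE : a = l + i :> nat by rewrite vtxK //; lia.
  have bE : b = l + m + i :> nat by rewrite vtxK //; lia.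
  have zE : z = l + 2 * m + i :> nat by rewrite vtxK //; lia.
  have adj_a y : hedgehog a y && (l <= y) -> y = b \/ y = z.
    rewrite /hedgehog /half_adj /= aE => ay.
    have : (y == b) || (y == z) by rewrite -!val_eqE /= bE zE; lia.
    by case/orP => /eqP; [left | right].
  have adj_b y : hedgehog b y && (l <= y) -> y = a \/ y = z.
    rewrite /hedgehog /half_adj /= bE => ay.
    have : (y == a) || (y == z) by rewrite -!val_eqE /= aE zE; lia.
    by case/orP => /eqP; [left | right].
  have ac : a < c by lia.
  have bc : b < c by lia.
  have [y1 [y2 [p1 p2 /adj_a ay1 /adj_a ay2]]] := nbrs a ac aB.
  have [y3 [y4 [p3 p4 /adj_b by3 /adj_b by4]]] := nbrs b bc bB.
  (* Three positions on the path would be pairwise consecutive. *)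
  by case: ay1 ay2 by3 by4 p1 p2 p3 p4 => -> [] -> [] -> [] ->; lia.
(* One bad vertex from each of the disjoint pairs injects at least [2 * l + 5] indices into a set of
   at most [2 * l + 4] vertices. *)
pose f (i : 'I_m) := if vtx (l + i) \in bad then vtx (l + i) else vtx (l + m + i).
have fI : injective f.
  move=> i j /(congr1 val) /=; rewrite /f => ij; apply: val_inj => /=.
  have im := ltn_ord i; have jm := ltn_ord j; move: ij.
  by case: ifP => _; case: ifP => _; rewrite !vtxK; lia.
have := subset_leq_card (_ : f @: setT \subset bad).
rewrite card_imset // cardsT card_ord => mb.
suff : m <= #|bad| by lia.
apply: mb; apply/subsetP => x /imsetP[i _ ->]; rewrite /f; have := pair_bad i.
by case: ifP.
Qed.

End Graph.

(** * Choice of parameters and conclusion *)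

Import GRing.Theory Num.Theory.
Local Open Scope ring_scope.

Theorem theorem2 (k : nat) (hk : (29 <= k)%N) (N : nat) :
  exists (n : nat) (e : rel 'I_n),
    [/\ (N <= n)%N, simple_graph e, ~ has_P2_P2k1_factor e k &
      forall X : {set 'I_n},
        ((\sum_(0 <= j < k) ncomp e X (2 * j + 1))%N%:R : rat)
          <= ((32 * k + 141)%N%:R / (72 * k - 78)%N%:R) * (#|X|%:R)].
Proof.
have [l [m [lmc lm qp]]] : exists l m, [/\ (l + 3 * m <= 2 * k + 3)%N, (2 * l + 5 <= m)%N &
    forall f, (f <= m)%N ->
      ((72 * k - 78) * f.+1 <= (32 * k + 141) * (l + 2 * f))%N].
  (* Both choices take [m = 2 * l + 5]. For [l = 2] the quotient of [f.+1] by [l + 2 * f] is always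
     1/2, and the target is at least 1/2 exactly up to [k = 45]. For [l = 7] it increases to 20/45 =
     4/9 at [f = 19], the limit of the target from above. *)
  have [k45 | k45] := leqP k 45.
    by exists 2, 9; split=> [||f fm]; [lia | lia | nia].
  by exists 7, 19; split=> [||f fm]; [lia | lia | nia].
pose n' := (2 * (2 * k + 3) + N)%N.
exists n'.+1, (@hedgehog (2 * k + 3) l m n').
have cn : (2 * k + 3 <= n'.+1)%N by rewrite /n'; lia.
split; [by rewrite /n'; lia | exact: hedgehog_simple | exact: hedgehog_no_factor |].
(* As [k >= 29], the truncated difference [72 * k - 78] is positive, so the denominator can be
   cleared. *)
move=> X; rewrite mulrAC ler_pdivlMr ?ltr0n; last by lia.
rewrite -!natrM ler_nat mulnC.
apply: (hedgehog_counted lmc cn) => //; rewrite /n'; lia.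
Qed.
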